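(* Let $w$ be a string over $\{0,1\}$ with $\#w\ge 2$ such that $\xi(l^2(w))=\xi(r^2(w))\neq 0$. Then $\xi(m(w))\neq 0$.
   Context: $\#w$ is the length of $w$, $\varepsilon$ the empty string; for $\#w\ge1$, $l(w)$ is $w$ without its last letter and $r(w)$ is $w$ without its first letter; $l^2=l\circ l$, $r^2=r\circ r$, and for $\#w\ge2$, $m(w)=l(r(w))$. $T^n$ is the alternating string of length $n$ starting with $0$ ($T^0=\varepsilon$, $T^n=T^{n-1}0$ for odd $n$, $T^n=T^{n-1}1$ for even $n\ge2$) and $CT^n$ its letterwise complement. $\xi:\{0,1\}^*\to\{-1,0,1\}$: $\xi(\varepsilon)=0$; $\xi(w)=1$ if $w=T^k$, $k\ge2$ even; $\xi(w)=-1$ if $w=CT^k$, $k\ge2$ even; otherwise $\xi(w)=\operatorname{sgn}(\xi(l(w))+\xi(r(w)))$. *)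

(* Defs.v *)
From mathcomp Require Import all_boot all_order all_algebra.

Set Implicit Arguments.
Unset Strict Implicit.
Unset Printing Implicit Defensive.

Import GRing.Theory.
Local Open Scope ring_scope.

(* The letters 0 and 1 are [false] and [true]. *)
Definition word := seq bool.

(* [l] and [r] are totalised by [l [::] = r [::] = [::]]. *)
Definition l (w : word) : word := take (size w).-1 w.
Definition r (w : word) : word := behead w.
Definition m (w : word) : word := l (r w).

Fixpoint T (n : nat) : word :=
  if n is n'.+1 then rcons (T n') (~~ odd n) else [::].

Definition CT (n : nat) : word := map negb (T n).

(* Since [size (T k) = size (CT k) = k], a word is of the form [T k] or [CT k]
   with [k >= 2] even only for [k = size w]. *)
Definition isTeven (w : word) : bool :=
  [&& (2 <= size w)%N, ~~ odd (size w) & w == T (size w)].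
Definition isCTeven (w : word) : bool :=
  [&& (2 <= size w)%N, ~~ odd (size w) & w == CT (size w)].

(* The fuel [n] stands for the length of [w], which decreases by one at each
   recursive call; the defining clauses of [xi] are [xi_nil], [xi_T], [xi_CT]
   and [xi_step] below. *)
Fixpoint xi_fuel (n : nat) (w : word) : int :=
  if n is n'.+1 then
    if isTeven w then 1
    else if isCTeven w then -1
    else Num.sg (xi_fuel n' (l w) + xi_fuel n' (r w))
  else 0.

Definition xi (w : word) : int := xi_fuel (size w) w.

Lemma size_T n : size (T n) = n.
Proof. by elim: n => //= n IHn; rewrite size_rcons IHn. Qed.

Lemma size_CT n : size (CT n) = n.
Proof. by rewrite size_map size_T. Qed.

Lemma l_rcons (w : word) (a : bool) : l (rcons w a) = w.
Proof. by rewrite /l size_rcons -cats1 take_size_cat. Qed.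

Lemma r_cons (a : bool) (w : word) : r (a :: w) = w.
Proof. by []. Qed.

Lemma isTevenP w :
  reflect (exists k, [/\ (2 <= k)%N, ~~ odd k & w = T k]) (isTeven w).
Proof.
apply: (iffP and3P) => [[? ? /eqP ?]|[k [? ? ->]]]; first by exists (size w).
by rewrite size_T.
Qed.

Lemma isCTevenP w :
  reflect (exists k, [/\ (2 <= k)%N, ~~ odd k & w = CT k]) (isCTeven w).
Proof.
apply: (iffP and3P) => [[? ? /eqP ?]|[k [? ? ->]]]; first by exists (size w).
by rewrite size_CT.
Qed.

Lemma xi_nil : xi [::] = 0.
Proof. by []. Qed.

Lemma xi_unfold w : w != [::] ->
  xi w = if isTeven w then 1 else if isCTeven w then -1
         else Num.sg (xi (l w) + xi (r w)).
Proof. by case: w => // a w _; rewrite /xi /= {2}/l size_takel //= leqnSn. Qed.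

Lemma xi_T k : (2 <= k)%N -> ~~ odd k -> xi (T k) = 1.
Proof.
move=> k2 ke; have /isTevenP eT : exists i, [/\ (2 <= i)%N, ~~ odd i & T k = T i]
  by exists k.
by rewrite xi_unfold ?eT // -size_eq0 size_T; case: k k2 {ke eT}.
Qed.

Lemma CT_neq_T k i : (0 < k)%N -> CT k <> T i.
Proof.
move=> k0 E; have Ek : k = i by rewrite -(size_CT k) E size_T.
subst i; case: k k0 E => // k _; rewrite /CT /= map_rcons => /rcons_inj [_].
by case: (odd k).
Qed.

Lemma xi_CT k : (2 <= k)%N -> ~~ odd k -> xi (CT k) = -1.
Proof.
move=> k2 ke.
have /isCTevenP eC : exists i, [/\ (2 <= i)%N, ~~ odd i & CT k = CT i]
  by exists k.
have eT : isTeven (CT k) = false.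
  by apply/isTevenP => -[i [_ _]]; apply: CT_neq_T; apply: ltnW.
by rewrite xi_unfold ?eT ?eC // -size_eq0 size_CT; case: k k2 {ke eT eC}.
Qed.

Lemma xi_step w : w <> [::] ->
  (forall k, (2 <= k)%N -> ~~ odd k -> w <> T k /\ w <> CT k) ->
  xi w = Num.sg (xi (l w) + xi (r w)).
Proof.
move=> /eqP w0 H; rewrite xi_unfold //.
case: isTevenP => [[k [k2 ke /(proj1 (H k k2 ke))]] //|_].
by case: isCTevenP => [[k [k2 ke /(proj2 (H k k2 ke))]] //|_].
Qed.

(* Main.v *)
Require Import Defs.
From mathcomp Require Import all_boot all_order all_algebra.
From mathcomp Require Import zify.

(** Fix a sequence [u] of letters and arrange the values of [xi] on its factors
    in rows, row [n] listing the factors of length [n] by starting position.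
    Away from alternating factors of even length, row [n.+1] is the sign of the
    sum of neighbours in row [n].  We show by induction on [n] that if two equal
    nonzero entries [s] of row [n] enclose [k >= 1] zeros, then [n] is odd,
    [k >= 2], and the enclosed factors all alternate.  The zeros of such a
    pattern arise either from [k + 1] zeros in the row below, still enclosed by
    [s], or from a run [s, -s, ..., s] of length [k + 1] in that row; such a run
    of length at least 3 occurs only in even rows, and there only among
    alternating factors.  Zeros of an odd row lying on alternating factors do not
    survive, since [xi] is nonzero on the alternating factors one row above.  The
    theorem is the case [k = 1]. *)

Set Implicit Arguments.
Unset Strict Implicit.
Unset Printing Implicit Defensive.

Import Order.TTheory GRing.Theory Num.Theory.
Local Open Scope ring_scope.

Implicit Types (u : nat -> bool) (s : int).

(** * Factors of a sequence and alternation *)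

Definition factor u n i : word := mkseq (fun j => u (i + j)%N) n.

Definition xif u n i : int := xi (factor u n i).

(** Positions are absolute, so passing to a subfactor or gluing overlapping factors is pure
    arithmetic. *)
Definition alternating u n i : Prop :=
  forall j, (i <= j)%N -> (j.+1 < i + n)%N -> u j.+1 = ~~ u j.

(** The value of [xi] on an alternating word of even length at least 2 with first letter [b]. *)
Definition letter_sign (b : bool) : int := if b then -1 else 1.

Lemma letter_signN b : letter_sign (~~ b) = - letter_sign b.
Proof. by case: b. Qed.

Lemma letter_sign_neq0 b : letter_sign b <> 0.
Proof. by case: b. Qed.

Lemma size_factor u n i : size (factor u n i) = n.
Proof. exact: size_mkseq. Qed.

Lemma l_factor u n i : l (factor u n.+1 i) = factor u n i.
Proof. by rewrite /factor /mkseq -addn1 iotaD map_cat /= cats1 l_rcons. Qed.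

Lemma r_factor u n i : r (factor u n.+1 i) = factor u n i.+1.
Proof.
rewrite /factor /mkseq /= (iotaDl 1 0) -map_comp; apply: eq_map => j /=.
by rewrite add1n addSnnS.
Qed.

Lemma T_mkseq n : T n = mkseq odd n.
Proof.
elim: n => //= n ->.
by rewrite negbK /mkseq -[n.+1]addn1 iotaD map_cat cats1.
Qed.

Lemma CT_mkseq n : CT n = mkseq (fun j => ~~ odd j) n.
Proof. by rewrite /CT T_mkseq /mkseq -map_comp. Qed.

Lemma factor_eq u n i (v : nat -> bool) :
  factor u n i = mkseq v n <-> forall j, (j < n)%N -> u (i + j)%N = v j.
Proof.
split=> [E j jn|E].
  by have := congr1 (fun x => nth false x j) E; rewrite !nth_mkseq.
by apply/eq_in_map => j; rewrite mem_iota => /andP[_ jn]; apply: E.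
Qed.

Lemma alternatingE u n i : alternating u n i ->
  forall j, (j < n)%N -> u (i + j)%N = u i (+) odd j.
Proof.
move=> A; elim=> [|j IH] jn; first by rewrite addn0 addbF.
by rewrite addnS A ?IH /= ?addbN //; lia.
Qed.

Lemma alternating_odd u n i b : (forall j, (j < n)%N -> u (i + j)%N = b (+) odd j) ->
  alternating u n i.
Proof.
move=> E j ij jn; have := E (j - i)%N; have := E (j.+1 - i)%N.
rewrite subSn // addnS subnKC //= => -> //; last by lia.
by move=> -> //; [rewrite addbN | lia].
Qed.

Lemma alternating_isT u n i : (2 <= n)%N -> ~~ odd n ->
  alternating u n i <-> isTeven (factor u n i) || isCTeven (factor u n i).
Proof.
move=> n2 ne; rewrite /isTeven /isCTeven size_factor n2 ne /= T_mkseq CT_mkseq.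
split=> [/alternatingE A|].
  case E: (u i) A => A; apply/orP; [right|left]; apply/eqP/factor_eq => j jn.
    by rewrite A.
  by rewrite A.
case/orP => /eqP/factor_eq E.
  by apply: (@alternating_odd _ _ _ false) => j jn; rewrite E.
by apply: (@alternating_odd _ _ _ true) => j jn; rewrite E.
Qed.

Lemma xif_alternating u n i : (2 <= n)%N -> ~~ odd n ->
  alternating u n i -> xif u n i = letter_sign (u i).
Proof.
move=> n2 ne /alternatingE A; rewrite /xif.
case E: (u i) A => A.
  suff -> : factor u n i = CT n by rewrite xi_CT.
  by rewrite CT_mkseq; apply/factor_eq => j jn; rewrite A.
suff -> : factor u n i = T n by rewrite xi_T.
by rewrite T_mkseq; apply/factor_eq => j jn; rewrite A.
Qed.

(** * The sign rule between consecutive rows *)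

Lemma xif_step u n i : (odd n.+1 \/ ~ alternating u n.+1 i) ->
  xif u n.+1 i = Num.sg (xif u n i + xif u n i.+1).
Proof.
move=> H; have nz : factor u n.+1 i != [::] by rewrite -size_eq0 size_factor.
rewrite /xif xi_unfold // l_factor r_factor.
case: (boolP (odd n.+1)) => [o|ne].
  by rewrite /isTeven /isCTeven size_factor o !andbF.
have n2 : (2 <= n.+1)%N by case: (n) ne.
case: H => [o|H]; first by rewrite o in ne.
case: ifP => [t|_]; first by case: H; apply/alternating_isT; rewrite ?t.
by case: ifP => [t|_] //; case: H; apply/alternating_isT; rewrite ?t ?orbT.
Qed.

Lemma xif0 u i : xif u 0 i = 0.
Proof. by []. Qed.

Lemma xif1 u i : xif u 1 i = 0.
Proof. by rewrite xif_step; [rewrite !xif0 | left]. Qed.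

Lemma alternating_dec u n i : alternating u n i \/ ~ alternating u n i.
Proof.
suff [A|A] : (all (fun j => u j.+1 == ~~ u j) (iota i n.-1)) \/
     ~~ (all (fun j => u j.+1 == ~~ u j) (iota i n.-1)).
- left=> j ij jn; apply/eqP; apply: (allP A); rewrite mem_iota; lia.
- right=> H; case/allPn: A => j; rewrite mem_iota => jn; rewrite H ?eqxx //; lia.
by case: all; [left|right].
Qed.

Lemma xif_range u n i : xif u n i = 1 \/ xif u n i = 0 \/ xif u n i = -1.
Proof.
case: n => [|n]; first by right; left.
have H : odd n.+1 \/ ~ alternating u n.+1 i ->
    xif u n.+1 i = 1 \/ xif u n.+1 i = 0 \/ xif u n.+1 i = -1.
  by move/xif_step=> ->; case: sgrP => _; [right; left|left|right; right].
case: (boolP (odd n.+1)) => [o|ne]; first by apply: H; left.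
case: (alternating_dec u n.+1 i) => [A|A]; last by apply: H; right.
rewrite xif_alternating //; last by case: (n) ne.
by case: (u i); [right; right | left].
Qed.

(** The sign rule split by cases, so that [lia] can combine it with [xif_range]. *)
Lemma xif_stepP u n i : (odd n.+1 \/ ~ alternating u n.+1 i) ->
  (0 < xif u n i + xif u n i.+1 -> xif u n.+1 i = 1) /\
  (xif u n i + xif u n i.+1 < 0 -> xif u n.+1 i = -1) /\
  (xif u n i + xif u n i.+1 = 0 -> xif u n.+1 i = 0).
Proof.
move/xif_step=> ->; split; first exact: gtr0_sg.
by split=> [|->]; [exact: ltr0_sg | rewrite sgr0].
Qed.

(** * Alternating factors and their extensions by one letter *)

Lemma alternatingS u n i : alternating u n i.+1 -> (0 < n)%N ->
  u i.+1 = ~~ u i -> alternating u n.+1 i.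
Proof.
move=> A n0 E j ij jn; case: (eqVneq j i) => [->//|ji]; apply: A; lia.
Qed.

Lemma alternating_rcons u n i : alternating u n i ->
  (0 < n)%N -> u (i + n)%N = ~~ u (i + n).-1 -> alternating u n.+1 i.
Proof.
move=> A n0 E j ij jn; case: (eqVneq j.+1 (i + n)%N) => [e|ji]; last by apply: A; lia.
by rewrite e E -e.
Qed.

(** For [n >= 3] the two factors below start with opposite letters, so their values cancel. *)
Lemma xif_odd_alternating u n i : odd n -> alternating u n i -> xif u n i = 0.
Proof.
case: n => // n o A; case: (ltnP 0 n) => [n0|]; last by case: (n) => // _; apply: xif1.
have ne : ~~ odd n by [].
have n2 : (2 <= n)%N by case: (n) n0 ne => [|[|]].
rewrite xif_step; last by left.
rewrite !xif_alternating //; try (move=> j ? ?; apply: A; lia).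
by rewrite A ?letter_signN ?subrr ?sgr0 //; lia.
Qed.

(** The left factor contributes [letter_sign (u i)]. The right one never has the opposite sign:
    below it lie an odd alternating factor, of value 0, and the same pattern shortened by two
    letters. *)
Lemma xif_alternating_rcons u k i : ~~ odd k -> (2 <= k)%N -> alternating u k i ->
  u (i + k)%N = u (i + k).-1 -> xif u k.+1 i = letter_sign (u i).
Proof.
elim/ltn_ind: k i => k IH i ke k2 A E.
have o : odd k.+1 by rewrite /= ke.
have := xif_stepP (or_introl o : odd k.+1 \/ ~ alternating u k.+1 i).
rewrite (xif_alternating k2 ke A) /=.
case: k k2 ke IH A E o => // -[//|k] _ ke IH A E o.
have nA : ~ alternating u k.+2 i.+1.
  move=> B; have := B (i + k.+1)%N; rewrite addnS /= in E *; rewrite E => H.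
  by have := H ltac:(lia) ltac:(lia); case: (u _).
have := xif_stepP (or_intror nA : odd k.+2 \/ _).
rewrite (xif_odd_alternating (n := k.+1) (i := i.+1)) //=; last first.
- by move=> j ? ?; apply: A; lia.
- by move: ke; rewrite /= !negbK.
(* At [k = 0] the shortened pattern is a single letter, of value 0; otherwise induction applies. *)
have : xif u k.+1 i.+2 = 0 \/ xif u k.+1 i.+2 = letter_sign (u i).
  case: (ltnP 0 k) => [k0|]; last by case: (k) => // _; left; apply: xif1.
  right; rewrite IH //; try lia.
  - by rewrite !A ?negbK //; lia.
  - by move=> j ? ?; apply: A; lia.
  - by rewrite !addSnnS.
by case: (u i) => /=; lia.
Qed.

(** Mirror image of [xif_alternating_rcons]. *)
Lemma xif_cons_alternating u k i : ~~ odd k -> (2 <= k)%N -> alternating u k i.+1 ->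
  u i = u i.+1 -> xif u k.+1 i = letter_sign (u i).
Proof.
elim/ltn_ind: k => k IH ke k2 A E.
have o : odd k.+1 by rewrite /= ke.
have := xif_stepP (or_introl o : odd k.+1 \/ ~ alternating u k.+1 i).
rewrite (xif_alternating k2 ke A) /= -E.
case: k k2 ke IH A o => // -[//|k] _ ke IH A o.
have nA : ~ alternating u k.+2 i.
  move=> B; have := B i; rewrite E => H.
  by have := H ltac:(lia) ltac:(lia); case: (u _).
have := xif_stepP (or_intror nA : odd k.+2 \/ _).
rewrite (xif_odd_alternating (n := k.+1) (i := i.+1)) //=; last first.
- by move=> j ? ?; apply: A; lia.
- by move: ke; rewrite /= !negbK.
have : xif u k.+1 i = 0 \/ xif u k.+1 i = letter_sign (u i).
  case: (ltnP 0 k) => [k0|]; last by case: (k) => // _; left; apply: xif1.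
  right; rewrite IH //; try lia.
  by move=> j ? ?; apply: A; lia.
by case: (u i) => /=; lia.
Qed.

(** * Runs of alternating sign *)

Lemma xif_sign_change u n i s : s <> 0 ->
  odd n.+1 \/ ~ alternating u n.+1 i -> odd n.+1 \/ ~ alternating u n.+1 i.+1 ->
  xif u n.+1 i = s -> xif u n.+1 i.+1 = - s -> xif u n i.+1 = 0.
Proof.
move=> s0 /xif_stepP st0 /xif_stepP st1 e0 e1.
have [e|[//|e]] := xif_range u n i.+1; move: st0 st1; rewrite e e0 e1.
  by have := xif_range u n i; have := xif_range u n i.+2; lia.
by have := xif_range u n i; have := xif_range u n i.+2; lia.
Qed.

(** At a sign change the shared entry below is 0, as a nonzero one would exclude one of the two
    signs. Two changes thus put the middle entry above two zeros. *)
Lemma xif_sign_alternation u n i s : s <> 0 ->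
  odd n.+1 \/ ~ alternating u n.+1 i -> odd n.+1 \/ ~ alternating u n.+1 i.+1 ->
  odd n.+1 \/ ~ alternating u n.+1 i.+2 ->
  xif u n.+1 i = s -> xif u n.+1 i.+1 = - s -> xif u n.+1 i.+2 = s -> False.
Proof.
move=> s0 H0 H1 H2 e0 e1 e2; have Ns0 : - s <> 0 by lia.
have z1 := xif_sign_change s0 H0 H1 e0 e1.
have z2 : xif u n i.+2 = 0 by apply: (xif_sign_change Ns0 H1 H2 e1); rewrite opprK.
by apply: Ns0; rewrite -e1 xif_step // z1 z2.
Qed.

Lemma odd_row_no_sign_alternation u n i s : odd n -> s <> 0 ->
  xif u n i = s -> xif u n i.+1 = - s -> xif u n i.+2 = s -> False.
Proof. by case: n => // n o s0; apply: xif_sign_alternation => //; left. Qed.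

Lemma alternating_nextP u n i : (0 < n)%N -> alternating u n i ->
  alternating u n.+1 i \/ ~ alternating u n.+1 i /\ u (i + n)%N = u (i + n).-1.
Proof.
move=> n0 A; case: (alternating_dec u n.+1 i) => B; [by left|right; split=> //].
by case: (eqVneq (u (i + n)%N) (~~ u (i + n).-1)) => [/(alternating_rcons A n0) //|];
  case: (u _) => //; case: (u _).
Qed.

Lemma alternating_prevP u n i : (0 < n)%N -> alternating u n i.+1 ->
  alternating u n.+1 i \/ ~ alternating u n.+1 i /\ u i = u i.+1.
Proof.
move=> n0 A; case: (alternating_dec u n.+1 i) => B; [by left|right; split=> //].
by case: (eqVneq (u i.+1) (~~ u i)) => [/(alternatingS A n0) //|];
  case: (u _) => //; case: (u _).
Qed.

(** If alternation broke at the next letter, the entry at [i.+1] would lie above an odd alternating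
    factor, of value 0, and above a single letter or a factor ending in a doubled letter, of value 0
    or [s]; it could not be [- s]. *)
Lemma even_row_next u n i s : ~~ odd n -> (2 <= n)%N -> s <> 0 ->
  alternating u n i -> xif u n i = s -> xif u n i.+1 = - s ->
  alternating u n.+1 i.
Proof.
move=> ne n2 s0 A; rewrite (xif_alternating n2 ne A) => es.
have [//|[B E]] := alternating_nextP (ltnW n2) A.
case: n n2 ne A B E => // n n2 ne A B E.
have nA : ~ alternating u n.+1 i.+1.
  by move=> C; apply: B; apply: alternatingS => //; apply: A; lia.
have := xif_stepP (or_intror nA : odd n.+1 \/ _).
rewrite (xif_odd_alternating (n := n) (i := i.+1)) //=; last first.
- by move=> j ? ?; apply: A; lia.
- by move: ne; rewrite /= negbK.
case: n n2 ne A B E {nA} => // n n2 ne A B E.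
have : xif u n.+1 i.+2 = 0 \/ xif u n.+1 i.+2 = letter_sign (u i).
  case: (ltnP 0 n) => [k0|]; last by case: (n) => // _; left; apply: xif1.
  right; rewrite xif_alternating_rcons //; try lia.
  - by rewrite !A ?negbK //; lia.
  - by move=> j ? ?; apply: A; lia.
  - by rewrite !addSnnS.
by move: es; case: (u i) => /=; lia.
Qed.

Lemma even_row_prev u n i s : ~~ odd n -> (2 <= n)%N -> s <> 0 ->
  alternating u n i.+1 -> xif u n i.+1 = s -> xif u n i = - s ->
  alternating u n.+1 i.
Proof.
move=> ne n2 s0 A; rewrite (xif_alternating n2 ne A) => es.
have [//|[B E]] := alternating_prevP (ltnW n2) A.
case: n n2 ne A B E => // n n2 ne A B E.
have nA : ~ alternating u n.+1 i.
  move=> C; have := C i; rewrite -E => H.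
  by have := H ltac:(lia) ltac:(lia); case: (u _).
have := xif_stepP (or_intror nA : odd n.+1 \/ _).
rewrite (xif_odd_alternating (n := n) (i := i.+1)) //=; last first.
- by move=> j ? ?; apply: A; lia.
- by move: ne; rewrite /= negbK.
case: n n2 ne A B {nA} => // n n2 ne A B.
have : xif u n.+1 i = 0 \/ xif u n.+1 i = letter_sign (u i).
  case: (ltnP 0 n) => [k0|]; last by case: (n) => // _; left; apply: xif1.
  right; rewrite xif_cons_alternating //; try lia.
  by move=> j ? ?; apply: A; lia.
by move: es; rewrite -E; case: (u i) => /=; lia.
Qed.

(** One of the three factors alternates; the sign changes carry this to the others through
    [even_row_next] and [even_row_prev], and the three are glued. *)
Lemma even_row_sign_alternation u n i s : ~~ odd n -> (2 <= n)%N -> s <> 0 ->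
  xif u n i = s -> xif u n i.+1 = - s -> xif u n i.+2 = s ->
  alternating u n.+2 i.
Proof.
move=> ne n2 s0 e0 e1 e2.
have Ns0 : - s <> 0 by lia.
have e0' : xif u n i = - - s by rewrite opprK.
have e2' : xif u n i.+2 = - - s by rewrite opprK.
(* The three values cannot all come from the sign rule. *)
have [A|[A|A]] : alternating u n i \/ alternating u n i.+1 \/ alternating u n i.+2.
- case: n ne n2 e0 e1 e2 {e0' e2'} => // n ne n2.
  have [|H0] := alternating_dec u n.+1 i; first by left.
  have [|H1] := alternating_dec u n.+1 i.+1; first by right; left.
  have [|H2] := alternating_dec u n.+1 i.+2; first by right; right.
  by move=> e0 e1 e2; case: (@xif_sign_alternation u n i s) => //; right.
- have A1 := even_row_next ne n2 s0 A e0 e1.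
  have B : alternating u n i.+1 by move=> j ? ?; apply: A1; lia.
  have B1 := even_row_next ne n2 Ns0 B e1 e2'.
  by apply: alternatingS => //; apply: A1; lia.
- have B1 := even_row_next ne n2 Ns0 A e1 e2'.
  have A1 := even_row_prev ne n2 Ns0 A e1 e0'.
  by apply: alternatingS => //; apply: A1; lia.
- have B1 := even_row_prev ne n2 s0 A e2 e1.
  have B : alternating u n i.+1 by move=> j ? ?; apply: B1; lia.
  have A1 := even_row_prev ne n2 Ns0 B e1 e0'.
  by apply: alternatingS => //; apply: A1; lia.
Qed.

(** * Zeros enclosed by equal signs *)

Lemma sum_zero_sign (a : nat -> int) i k :
  (forall j, (j < k)%N -> a (i + j)%N + a (i + j).+1 = 0) ->
  forall j, (j <= k)%N -> a (i + j)%N = if odd j then - a i else a i.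
Proof.
move=> H; elim=> [|j IH] jk; first by rewrite addn0.
by have := H j jk; rewrite addnS IH 1?ltnW //=; case: (odd j) => /=; lia.
Qed.

(** The zeros force one constant letter; the left end is a change into that letter, the right end a
    change out of it, and these have opposite values. *)
Lemma even_row2_no_enclosed_zeros u i k s : s <> 0 ->
  xif u 2 i = s -> xif u 2 (i + k.+1)%N = s ->
  (forall j, (0 < j <= k)%N -> xif u 2 (i + j)%N = 0) -> (0 < k)%N -> False.
Proof.
move=> s0 e0 ek z k0.
have xif2 j : xif u 2 j = if u j == u j.+1 then 0 else letter_sign (u j).
  case: (alternating_dec u 2 j) => A.
    by rewrite xif_alternating // (A j) //; [case: (u j) | lia].
  rewrite xif_step; last by right.
  rewrite !xif1; case: eqP => // ne; case: A => t ? ?.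
  have -> : t = j by lia.
  by case: (u j) ne => //; case: (u _).
have c j : (j <= k)%N -> u (i + j).+1 = u i.+1.
  elim: j => [|j IH] jk; first by rewrite addn0.
  have := z j.+1 jk; rewrite addnS xif2 IH 1?ltnW //.
  by case: eqP => // _ /letter_sign_neq0.
move: e0 ek; rewrite !xif2 addnS c //.
by case: eqP; [lia|]; case: eqP; [lia|]; case: (u i); case: (u i.+1) => //=; lia.
Qed.

(** For even [n] the conclusion is absurd; the alternation clause is what an odd row passes up to
    refute the even row above it. *)
Lemma enclosed_zeros u n i k s : s <> 0 -> (0 < k)%N ->
  xif u n i = s -> xif u n (i + k.+1)%N = s ->
  (forall j, (0 < j <= k)%N -> xif u n (i + j)%N = 0) ->
  [/\ odd n, (2 <= k)%N & forall j, (0 < j <= k)%N -> alternating u n (i + j)].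
Proof.
elim: n i k => [|n IH] i k s0 k0 e0 ek z; first by rewrite -e0 in s0.
case: (boolP (odd n.+1)) => [o|ne].
  have n2 : (2 <= n)%N.
    case: n o {IH z ek} e0 => [|[|//]] // _ e0; by rewrite -e0 xif1 in s0.
  have st j := xif_stepP (or_introl o : _ \/ ~ alternating u n.+1 j).
  have ne : ~~ odd n by [].
  have zz : forall j, (j < k)%N -> xif u n (i.+1 + j)%N + xif u n (i.+1 + j).+1 = 0.
    move=> j jk; have := z j.+1 jk; rewrite addnS -addSn.
    by have := xif_range u n (i.+1 + j); have := xif_range u n (i.+1 + j).+1;
      have := st (i.+1 + j)%N; lia.
  have sgn := sum_zero_sign zz.
  have l0 := st i; have lk := st (i + k.+1)%N.
  have := sgn k (leqnn k); rewrite addSnnS => sk.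
  have r0 := xif_range u n i; have r1 := xif_range u n i.+1.
  have r2 := xif_range u n (i + k.+1).+1.
  (* By [sgn], the [k + 1] entries below are all 0 or alternate in sign. All 0 would be an enclosed
     pattern in an even row. *)
  have [a0|a0] := eqVneq (xif u n i.+1) 0.
    have /IH : xif u n i = s by lia.
    case/(_ k.+1) => //.
    - by rewrite addnS; case: (odd k) sk; lia.
    - move=> j /andP[j0 jk]; rewrite -[j]prednK // -addSnnS.
      by rewrite sgn ?a0 ?oppr0 ?if_same //; lia.
    - by rewrite (negPf ne).
  have a1 : xif u n i.+1 = s by lia.
  have ke : ~~ odd k by case: (odd k) sk => //; lia.
  have k2 : (2 <= k)%N by case: (k) k0 ke => [|[|]].
  split=> // j /andP[j0 jk].
  have tri t : (t.+2 <= k)%N -> alternating u n.+2 (i.+1 + t).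
    move=> tk; have tk1 := ltnW tk; have tk0 := ltnW tk1.
    apply: (even_row_sign_alternation (s := xif u n (i.+1 + t)%N)) => //.
    - by rewrite sgn // a1; case: (odd t) => /=; lia.
    - by rewrite -addnS !sgn //= ; case: (odd t); rewrite /= ?opprK.
    - by rewrite -!addnS !sgn //= negbK.
  have [jlt|jge] := ltnP j k.
    have := @tri j.-1; rewrite addSnnS prednK // => A t ? ?; apply: A; lia.
  (* Here [j = k]: the last factor is the tail of the stretch given by the last triple. *)
  have := @tri j.-2 => A t ? ?; apply: A; lia.
case: (eqVneq n 1%N) => [n1|n1].
  by case: (@even_row2_no_enclosed_zeros u i k s) => //; rewrite n1 in e0 ek z.
have o : odd n by move: ne; rewrite /= negbK.
have n3 : (3 <= n)%N by case: (n) o n1 => [|[|[|]]].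
have nA j : (0 < j <= k)%N -> ~ alternating u n.+1 (i + j).
  move=> jk A; have := z j jk; rewrite xif_alternating //; first exact: letter_sign_neq0.
  by lia.
have st j jk := xif_stepP (or_intror (nA j jk) : odd n.+1 \/ _).
have zz : forall j, (j < k)%N -> xif u n (i.+1 + j)%N + xif u n (i.+1 + j).+1 = 0.
  move=> j jk; have := z j.+1 jk; have := st j.+1 jk; rewrite addnS -addSn.
  have := xif_range u n (i.+1 + j); have := xif_range u n (i.+1 + j).+1.
  by lia.
have sgn := sum_zero_sign zz.
have := sgn k (leqnn k); rewrite addSnnS => sk.
have r0 := xif_range u n i; have r1 := xif_range u n i.+1.
have r2 := xif_range u n (i + k.+1).+1.
have [a0|a0] := eqVneq (xif u n i.+1) 0.
  have az j : (0 < j <= k.+1)%N -> xif u n (i + j)%N = 0.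
    move=> /andP[j0 jk]; rewrite -[j]prednK // -addSnnS.
    by rewrite sgn ?a0 ?oppr0 ?if_same //; lia.
  (* The sign rule may fail at the end [i]. If that factor alternates, [nA] forces a doubled letter
     just after it, which makes the entry at [i + 2] nonzero, against [az]. *)
  have b0 : xif u n i = s.
    case: (alternating_dec u n.+1 i) => A; last first.
      by have := xif_stepP (or_intror A : odd n.+1 \/ _); lia.
    have [B|[_ E]] := alternating_nextP (ltn0Sn n) A.
      by case: (nA 1%N) => //; rewrite ?addn1 => t ? ?; apply: B; lia.
    have A' : alternating u n.-1 i.+2 by move=> t ? ?; apply: A; lia.
    have E' : u (i.+2 + n.-1)%N = u (i.+2 + n.-1).-1.
      by have -> : (i.+2 + n.-1)%N = (i + n.+1)%N by lia.
    have := xif_alternating_rcons (_ : ~~ odd n.-1) (_ : (2 <= n.-1)%N) A' E'.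
    rewrite prednK; last by lia.
    rewrite -(addn2 i) az // => H.
    by case: (@letter_sign_neq0 (u (i + 2)%N)); rewrite -H //; lia.
  (* Symmetrically, a doubled letter in front would make the entry at [i + k] nonzero. *)
  have bk : xif u n (i + k.+2)%N = s.
    rewrite addnS.
    case: (alternating_dec u n.+1 (i + k.+1)) => A; last first.
      by have := xif_stepP (or_intror A : odd n.+1 \/ _); case: (odd k) sk; lia.
    rewrite addnS in A.
    have [B|[_ E]] := alternating_prevP (ltn0Sn n) A.
      by case: (nA k) => [|t ? ?]; [lia|]; apply: B; lia.
    have kk : (0 < k <= k.+1)%N by lia.
    have A' : alternating u n.-1 (i + k).+1 by move=> t ? ?; apply: A; lia.
    have := xif_cons_alternating (_ : ~~ odd n.-1) (_ : (2 <= n.-1)%N) A' E.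
    rewrite prednK; last by lia.
    rewrite az // => H.
    by case: (@letter_sign_neq0 (u (i + k)%N)); rewrite -H //; lia.
  (* The first two enclosed factors of the odd row alternate; glued, they contradict [nA] at 1. *)
  have [_ _ A] := IH i k.+1 s0 isT b0 bk az.
  case: (nA 1%N) => //.
  have A1 := A 1%N isT; have A2 := A 2 k0.
  rewrite addn1 in A1 *; rewrite addn2 in A2.
  by apply: alternatingS => //; [lia | apply: A1; lia].
(* An alternating end factor would contain an odd alternating factor at [i.+1], of value 0, so the
   sign rule applies at this end. *)
have a1 : xif u n i.+1 = s.
  case: (alternating_dec u n.+1 i) => A.
    by rewrite xif_odd_alternating // in a0 => t ? ?; apply: A; lia.
  by have := xif_stepP (or_intror A : odd n.+1 \/ _); lia.
have ke : ~~ odd k.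
  apply/negP => ok; rewrite ok a1 in sk.
  case: (alternating_dec u n.+1 (i + k.+1)) => A.
    by rewrite xif_odd_alternating // in sk; [lia | move=> t ? ?; apply: A; lia].
  by have := xif_stepP (or_intror A : odd n.+1 \/ _); lia.
have k2 : (2 <= k)%N by case: (k) k0 ke => [|[|]].
case: (@odd_row_no_sign_alternation u n i.+1 s) => //.
- by have := sgn 1%N k0; rewrite addn1 a1.
- by have := sgn 2 k2; rewrite addn2 a1.
Qed.

(** * Back to words *)

Lemma factor_nth w : factor (nth false w) (size w) 0 = w.
Proof. exact: mkseq_nth. Qed.

Theorem theorem2p14 (w : word) (hw : (2 <= size w)%N)
  (hlr : xi (l (l w)) = xi (r (r w))) (hnz : xi (r (r w)) <> 0) :
  xi (m w) <> 0.
Proof.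
(* With [u := nth false w], the words [l (l w)], [m w] and [r (r w)] become the factors at 0, 1 and
   2 in row [size w - 2]. *)
move: hlr hnz; rewrite /m -(factor_nth w).
case: (size w) hw => [|[|n]] // _.
rewrite !(l_factor, r_factor) => hlr hnz h0.
have [|_] := @enclosed_zeros (nth false w) n 0 1 _ hnz isT hlr (erefl _).
  by case=> [|[|]].
by [].
Qed.
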